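(* Let $n\ge 4$ and let $\mathcal{C}^n=(M^n,K(p))$ be the $n$-dimensional locally Minkowski-Cartan space endowed with the Berwald-Moór metric of momenta $K(p)=\sqrt[n]{p_1p_2\cdots p_n}$, considered on the domain $p_1>0,\dots,p_n>0$. Then: 1. the torsion covector $C^i=C_r^{ir}$ vanishes; 2. $\mathcal{C}^n$ is $S3$-like with the scalar function $S=-1$, that is, $K^2S^{hijk}=-\left\{h^{hj}h^{ik}-h^{hk}h^{ij}\right\}$ for all indices $h,i,j,k$; 3. the $T$-tensor $T^{hijk}$ vanishes.
   Context: The summation convention is used; indices (including the index $h$) run over $1,\dots,n$; $p=(p_1,\dots,p_n)$ are the momentum coordinates on the fibres of $T^*M$ in local coordinates in which $K$ depends on $p$ only and has the stated form; $\dot\partial^i=\partial/\partial p_i$. Definitions: $g^{ij}=\frac12\dot\partial^i\dot\partial^jK^2$, with inverse matrix $(g_{ij})$; $l^i=\dot\partial^iK$; the angular metrical d-tensor is $h^{ij}=K\dot\partial^i\dot\partial^jK$; the $v$-torsion d-tensor is $C^{ijk}=-\frac12\dot\partial^kg^{ij}$; $C_i^{jk}=g_{is}C^{sjk}$; the torsion covector is $C^i=C_r^{ir}$ (sum over $r$); the $v$-curvature d-tensor is $S^{hijk}=C_r^{ij}C^{rhk}-C_r^{ik}C^{rhj}$. The space is called $S3$-like with scalar function $S$ if $S=S(x,p)$ is a scalar function positively $0$-homogeneous in $p$ such that $K^2S^{hijk}=S\left\{h^{hj}h^{ik}-h^{hk}h^{ij}\right\}$. The $T$-tensor is $T^{hijk}=K\,C^{hij}|^k+l^hC^{ijk}+l^iC^{jkh}+l^jC^{khi}+l^kC^{hij}$,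 where $|^k$ is the local $v$-covariant derivation, i.e. $C^{hij}|^k=\dot\partial^kC^{hij}+C^{rij}C_r^{hk}+C^{hrj}C_r^{ik}+C^{hir}C_r^{jk}$. *)

(* Defs.v *)
From HB Require Import structures.
From mathcomp Require Import all_boot all_order all_algebra.
From mathcomp Require Import all_classical all_reals all_analysis.

Set Implicit Arguments.
Unset Strict Implicit.
Unset Printing Implicit Defensive.

Import Order.TTheory GRing.Theory Num.Theory.
Import numFieldNormedType.Exports.

Local Open Scope ring_scope.

Section CartanTensors.
Variables (R : realType) (n : nat).

Definition dmom (i : 'I_n) (f : 'rV[R]_n -> R) : 'rV[R]_n -> R :=
  fun p => 'D_(delta_mx 0 i) f p.

(* All the tensors below are vertical: they only involve the restriction
   F = K(x, .) of the fundamental function to the fibre over a point x, in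
   the coordinates p = (p_1, ..., p_n).  A name ending in "up" has all its
   indices raised; in "cartanC1 F r j k" the first index r is lowered. *)
Variable F : 'rV[R]_n -> R.

Definition gup (i j : 'I_n) (p : 'rV[R]_n) : R :=
  2^-1 * dmom i (dmom j (fun q => F q ^+ 2)) p.

Definition gdown (i j : 'I_n) (p : 'rV[R]_n) : R :=
  invmx (\matrix_(a < n, b < n) gup a b p) i j.

Definition lup (i : 'I_n) (p : 'rV[R]_n) : R := dmom i F p.

Definition hup (i j : 'I_n) (p : 'rV[R]_n) : R := F p * dmom i (dmom j F) p.

Definition cartanCup (i j k : 'I_n) (p : 'rV[R]_n) : R :=
  - 2^-1 * dmom k (gup i j) p.

Definition cartanC1 (i j k : 'I_n) (p : 'rV[R]_n) : R :=
  \sum_(s < n) gdown i s p * cartanCup s j k p.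

Definition torsion_covector (i : 'I_n) (p : 'rV[R]_n) : R :=
  \sum_(r < n) cartanC1 r i r p.

Definition vcurvature (h i j k : 'I_n) (p : 'rV[R]_n) : R :=
  (\sum_(r < n) cartanC1 r i j p * cartanCup r h k p)
  - \sum_(r < n) cartanC1 r i k p * cartanCup r h j p.

(* C^{hij}|^k *)
Definition vcovC (h i j k : 'I_n) (p : 'rV[R]_n) : R :=
  dmom k (cartanCup h i j) p
  + (\sum_(r < n) cartanCup r i j p * cartanC1 r h k p)
  + (\sum_(r < n) cartanCup h r j p * cartanC1 r i k p)
  + (\sum_(r < n) cartanCup h i r p * cartanC1 r j k p).

Definition Ttensor (h i j k : 'I_n) (p : 'rV[R]_n) : R :=
  F p * vcovC h i j k p
  + lup h p * cartanCup i j k p + lup i p * cartanCup j k h p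
  + lup j p * cartanCup k h i p + lup k p * cartanCup h i j p.

End CartanTensors.

(* K and S are functions of (x, p), with x the coordinates of the base point
   in a chart U and p ranging over a domain D of momenta in each fibre. *)
Definition S3_like (R : realType) (n : nat) (U D : set 'rV[R]_n)
    (K S : 'rV[R]_n -> 'rV[R]_n -> R) : Prop :=
  (forall x p (t : R), U x -> D p -> 0 < t -> S x (t *: p) = S x p) /\
  (forall x p, U x -> D p -> forall h i j k : 'I_n,
    K x p ^+ 2 * vcurvature (K x) h i j k p =
    S x p * (hup (K x) h j p * hup (K x) i k p
             - hup (K x) h k p * hup (K x) i j p)).

Definition positive_momenta (R : realType) (n : nat) : set 'rV[R]_n :=
  [set p : 'rV[R]_n | forall i : 'I_n, 0 < p 0 i]%classic.
Arguments positive_momenta : clear implicits.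

(* The metric does not depend on the base point x.  On positive_momenta R n
   the product is positive, so that powR is the usual n-th root. *)
Definition berwald_moor (R : realType) (n : nat) (x p : 'rV[R]_n) : R :=
  powR (\prod_(i < n) p 0 i) (n%:R^-1).
Arguments berwald_moor : clear implicits.

(* Main.v *)
(* On [p_i > 0] every function involved is a constant times a monomial in
   [K = (p_1 ... p_n)^a], [a = 1 / n], and the [1 / p_i]; such a monomial [f]
   satisfies [d f / d p_k = w_k f / p_k] with [w_k] constant.  Hence
   [g^ij = K^2 (2 a^2 - a delta_ij) / (p_i p_j)], with inverse
   [g_ij = p_i p_j (2 - n delta_ij) / K^2], and
   [C^ijk = - K^2 c_ijk / (p_i p_j p_k)] with [c_ijk] a symmetric constant
   array.  Since [sum_r c_rij = 0], the 2-term of [g_ij] drops out and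
   [C_i^jk = n c_ijk p_i / (p_j p_k)]; everything then reduces to the contraction
   [sum_r c_rij c_rhk = a delta_ij c_ihk - a^2 (c_ihk + c_jhk)]. *)

Require Import Defs.
From mathcomp Require Import all_boot all_order all_algebra.
From mathcomp Require Import all_classical all_reals all_analysis.
From mathcomp Require Import ring.

Set Implicit Arguments.
Unset Strict Implicit.
Unset Printing Implicit Defensive.

Import Order.TTheory GRing.Theory Num.Theory.
Import numFieldNormedType.Exports.
Local Open Scope ring_scope.

(** * Directional derivatives on the open cone of positive momenta *)

(** The difference quotient of the restriction to the line, taken at 0, is the directional one of
    [f] at [x]. This lets the one-variable rules for inverses and powers compute momentum
    derivatives. *)
Lemma is_derive_along_line (R : realType) (V W : normedModType R) (f : V -> W)
    (x v : V) (d : W) :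
  is_derive (0 : R) 1 (fun t => f (t *: v + x)) d -> is_derive x v f d.
Proof.
have E : (fun h : R => h^-1 *: (((fun t => f (t *: v + x)) \o shift 0) (h *: 1)
             - f (0 *: v + x)))
       = (fun h : R => h^-1 *: ((f \o shift x) (h *: v) - f x)).
  by apply/funext => h /=; rewrite scale0r add0r addr0 /GRing.scale /= mulr1.
by case=> dv vd; split; [move: dv; rewrite /derivable E | move: vd; rewrite /derive E].
Qed.

Lemma natr_ord_neq0 (R : numDomainType) (n : nat) (i : 'I_n) :
  n%:R != 0 :> R.
Proof. by rewrite pnatr_eq0 -lt0n (leq_ltn_trans _ (ltn_ord i)). Qed.

Lemma positive_momenta_neq0 (R : realType) (n : nat) (p : 'rV[R]_n) (i : 'I_n) :
  positive_momenta R n p -> p 0 i != 0.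
Proof. by move=> Dp; rewrite gt_eqF. Qed.

Lemma open_positive_momenta (R : realType) (n : nat) :
  open (positive_momenta R n).
Proof.
rewrite openE => p Dp; rewrite /interior.
apply: (@filter_forall _ _ (fun i (q : 'rV[R]_n) => 0 < q 0 i)
  (nbhs (p : 'rV[R]_n)) _) => i.
apply: (@coord_continuous R 1 n 0 i p [set t | 0 < t]%classic).
exact: lt_nbhsr.
Qed.

(** Differentiation is local. This allows a closed formula known only for positive momenta to be
    substituted under [dmom], hence derivatives to be iterated. *)
Lemma dmom_eq_on (R : realType) (n : nat) (D : set 'rV[R]_n)
    (f g : 'rV[R]_n -> R) (k : 'I_n) (p : 'rV[R]_n) :
  open D -> D p -> (forall q, D q -> f q = g q) -> dmom k f p = dmom k g p.
Proof.
move=> oD Dp fg; apply: near_eq_derive.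
have : \forall q \near p, D q by exact: open_nbhs_nbhs.
by apply: filterS => q /fg.
Qed.

(** * Calculus of logarithmic weights *)

(* [w k] is the logarithmic derivative [p_k * (d log f / d p_k)]. *)
Definition has_log_weight (R : realType) (n : nat) (f : 'rV[R]_n -> R)
    (w : 'I_n -> R) : Prop :=
  forall p, positive_momenta R n p ->
  forall k, is_derive p (delta_mx 0 k) f (w k * (p 0 k)^-1 * f p).

Lemma dmom_log_weight (R : realType) (n : nat) (f g : 'rV[R]_n -> R)
    (w : 'I_n -> R) (k : 'I_n) (p : 'rV[R]_n) :
  has_log_weight g w -> (forall q, positive_momenta R n q -> f q = g q) ->
  positive_momenta R n p -> dmom k f p = w k * (p 0 k)^-1 * g p.
Proof.
move=> gw fg Dp; rewrite (dmom_eq_on k (@open_positive_momenta R n) Dp fg).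
by case: (gw p Dp k).
Qed.

Lemma log_weightM (R : realType) (n : nat) (f g : 'rV[R]_n -> R)
    (v w : 'I_n -> R) :
  has_log_weight f v -> has_log_weight g w ->
  has_log_weight (fun p => f p * g p) (fun k => v k + w k).
Proof.
move=> fv gw p Dp k; have := is_deriveM (fv p Dp k) (gw p Dp k).
move/is_derive_eq; apply; rewrite /GRing.scale /=; ring.
Qed.

Lemma log_weight_cst (R : realType) (n : nat) (c : R) :
  has_log_weight (fun _ : 'rV[R]_n => c) (fun=> 0).
Proof.
move=> p _ k; have := is_derive_cst c p (delta_mx 0 k).
move/is_derive_eq; apply.
by rewrite !mul0r.
Qed.

Arguments log_weight_cst {R} n c.

Lemma log_weight_inv_coord (R : realType) (n : nat) (i : 'I_n) :
  has_log_weight (fun p : 'rV[R]_n => (p 0 i)^-1) (fun k => - (i == k)%:R).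
Proof.
move=> p Dp k; apply: is_derive_along_line.
have -> : (fun t : R => ((t *: delta_mx 0 k + p) 0 i)^-1)
        = (fun t : R => ((i == k)%:R * t + p 0 i)^-1).
  by apply/funext => t; rewrite !mxE eqxx /= mulrC.
have d : is_derive (0 : R) 1 (fun t : R => (i == k)%:R * t + p 0 i) (i == k)%:R.
  apply: is_derive_eq; rewrite /GRing.scale /=; ring.
have p0 : p 0 i != 0 by rewrite gt_eqF.
have nz : (i == k)%:R * 0 + p 0 i != 0 by rewrite mulr0 add0r.
have := is_deriveV (f := fun t : R => (i == k)%:R * t + p 0 i) nz d.
move/is_derive_eq; apply.
rewrite mulr0 add0r /GRing.scale /=.
case: eqVneq => [<-|_]; last by rewrite oppr0 mulr0 !mul0r.
by rewrite /=; field.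
Qed.

Arguments log_weight_inv_coord R {n} i.

Lemma log_weight_berwald_moor (R : realType) (n : nat) (x : 'rV[R]_n) :
  has_log_weight (berwald_moor R n x) (fun=> n%:R^-1).
Proof.
move=> p Dp k; apply: is_derive_along_line; rewrite /berwald_moor.
set P := \prod_(i < n) p 0 i.
have P_gt0 : 0 < P by apply: prodr_gt0 => i _; exact: Dp.
have pk0 : p 0 k != 0 by rewrite gt_eqF.
(* The product is linear in each single coordinate, so moving by [t] along the [k]-th axis adds
   [t * P / p_k] to it. *)
have -> : (fun t : R => powR (\prod_(i < n) (t *: delta_mx 0 k + p) 0 i) n%:R^-1)
        = (fun t : R => powR (P / p 0 k * t + P) n%:R^-1).
  apply/funext => t; congr powR.
  rewrite /P (bigD1 k) //= [in RHS](bigD1 k) //= !mxE !eqxx.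
  under eq_bigr => i ik do rewrite !mxE eqxx (negbTE ik) mulr0 add0r.
  by rewrite /=; field.
have d : is_derive (0 : R) 1 (fun t : R => P / p 0 k * t + P) (P / p 0 k).
  apply: is_derive_eq; rewrite /GRing.scale /=; ring.
have P0 : P / p 0 k * 0 + P = P by rewrite mulr0 add0r.
have dP : is_derive (P / p 0 k * 0 + P) 1 (fun t => powR t n%:R^-1)
    (n%:R^-1 * powR P (n%:R^-1 - 1)).
  by rewrite P0; exact: is_derive1_powR.
have := is_derive1_comp (f := fun s => powR s n%:R^-1)
  (g := fun t : R => P / p 0 k * t + P) dP d.
move/is_derive_eq; apply.
have PN : P != 0 by rewrite gt_eqF.
have -> : powR P (n%:R^-1 - 1) = powR P n%:R^-1 / P.
  by rewrite powRB ?PN ?implybT // powRr1 // ltW.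
have n0 := natr_ord_neq0 R k.
by field; rewrite pk0 n0 PN.
Qed.

(** * Contractions of the constant coefficient arrays *)

Lemma sum_delta (R : nzRingType) (n : nat) (i : 'I_n) (f : 'I_n -> R) :
  \sum_(r < n) (r == i)%:R * f r = f i.
Proof.
rewrite (bigD1 i) //= eqxx mul1r big1 ?addr0 // => r ri.
by rewrite (negbTE ri) mul0r.
Qed.

Lemma sum_cst_delta2 (R : nzRingType) (n : nat) (i j : 'I_n) (b : R)
    (u v : 'I_n -> R) :
  \sum_(r < n) (b + (r == i)%:R * u r + (r == j)%:R * v r) = n%:R * b + u i + v j.
Proof.
by rewrite big_split big_split /= !sum_delta sumr_const card_ord mulr_natl.
Qed.

Definition metric_coef (R : realType) (n : nat) (i j : 'I_n) : R :=
  2 * n%:R^-1 ^+ 2 - n%:R^-1 * (i == j)%:R.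

(** This is half of [metric_coef R i j] times the weight [2a - delta_ik - delta_jk] of [g^ij],
    rewritten to be symmetric in the three indices. *)
Definition torsion_coef (R : realType) (n : nat) (i j k : 'I_n) : R :=
  2 * n%:R^-1 ^+ 3
  - n%:R^-1 ^+ 2 * ((i == j)%:R + (j == k)%:R + (k == i)%:R)
  + n%:R^-1 * ((i == j)%:R * (j == k)%:R).

(** Only the cubic delta term is not visibly invariant. Together with [torsion_coef_swap] this
    generates all permutations of the indices. *)
Lemma torsion_coef_rot (R : realType) (n : nat) (i j k : 'I_n) :
  torsion_coef R i j k = torsion_coef R j k i.
Proof.
rewrite /torsion_coef.
have -> : (i == j)%:R * (j == k)%:R = (j == k)%:R * (k == i)%:R :> R.
  have [->|_] := eqVneq j k; last by rewrite mulr0 mul0r.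
  by rewrite mul1r mulr1 eq_sym.
by congr (_ - _ * _ + _); ring.
Qed.

Lemma torsion_coef_swap (R : realType) (n : nat) (i j k : 'I_n) :
  torsion_coef R i j k = torsion_coef R j i k.
Proof.
rewrite /torsion_coef (eq_sym j i) (eq_sym i k) (eq_sym k j).
have -> : (i == j)%:R * (j == k)%:R = (i == j)%:R * (k == i)%:R :> R.
  have [->|_] := eqVneq i j; last by rewrite !mul0r.
  by rewrite eq_sym.
by rewrite (eq_sym k i); ring.
Qed.

(** Since [n a = 1], the constant part sums to [2a^2 - a delta_ij], and the terms at [r = i] and
    [r = j] contribute [a delta_ij - 2a^2]. *)
Lemma sum_torsion_coef (R : realType) (n : nat) (i j : 'I_n) :
  \sum_(r < n) torsion_coef R r i j = 0.
Proof.
have n0 := natr_ord_neq0 R i.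
pose a : R := n%:R^-1.
rewrite (eq_bigr (fun r => (2 * a ^+ 3 - a ^+ 2 * (i == j)%:R)
     + (r == i)%:R * (a * (i == j)%:R - a ^+ 2) + (r == j)%:R * (- a ^+ 2))); last first.
  by move=> r _; rewrite /torsion_coef -/a (eq_sym j r); ring.
rewrite (sum_cst_delta2 _ _ _ (fun=> _) (fun=> _)) /a.
by field.
Qed.

Lemma sum_torsion_coefM (R : realType) (n : nat) (i j : 'I_n) (f : 'I_n -> R) :
  \sum_(r < n) torsion_coef R r i j * f r =
  (2 * n%:R^-1 ^+ 3 - n%:R^-1 ^+ 2 * (i == j)%:R) * \sum_(r < n) f r
  - n%:R^-1 ^+ 2 * (f i + f j) + n%:R^-1 * (i == j)%:R * f i.
Proof.
pose a : R := n%:R^-1.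
rewrite (eq_bigr (fun r => (2 * a ^+ 3 - a ^+ 2 * (i == j)%:R) * f r
     + (r == i)%:R * ((a * (i == j)%:R - a ^+ 2) * f r)
     + (r == j)%:R * (- a ^+ 2 * f r))); last first.
  by move=> r _; rewrite /torsion_coef -/a (eq_sym j r); ring.
rewrite big_split big_split /= !sum_delta -mulr_sumr -/a; ring.
Qed.

(** Taking [f r = c_rhk] in [sum_torsion_coefM], the full sum of [f] vanishes and only the terms
    located at [i] and [j] survive. *)
Lemma sum_torsion_coef_sq (R : realType) (n : nat) (i j h k : 'I_n) :
  \sum_(r < n) torsion_coef R r i j * torsion_coef R r h k =
  n%:R^-1 * (i == j)%:R * torsion_coef R i h k
  - n%:R^-1 ^+ 2 * (torsion_coef R i h k + torsion_coef R j h k).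
Proof. by rewrite sum_torsion_coefM sum_torsion_coef; ring. Qed.

(** The S3-like identity with its common monomial factor removed. *)
Lemma torsion_coef_curvature (R : realType) (n : nat) (h i j k : 'I_n) :
  let a : R := n%:R^-1 in let c := @torsion_coef R n in
  a * (c i h k + c j h k) - (i == j)%:R * c i h k
  - (a * (c i h j + c k h j) - (i == k)%:R * c i h j) =
  (a ^+ 2 - a * (h == k)%:R) * (a ^+ 2 - a * (i == j)%:R)
  - (a ^+ 2 - a * (h == j)%:R) * (a ^+ 2 - a * (i == k)%:R).
Proof.
move=> a c.
have -> : c k h j = c j h k.
  by rewrite /c torsion_coef_rot torsion_coef_swap 2!torsion_coef_rot.
(* [c_jhk] enters both halves with coefficient [a] and cancels, so its value is irrelevant. *)
move: (c j h k) => e; rewrite /c /torsion_coef -/a (eq_sym k i) (eq_sym j i).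
(* If [i = h], deltas in [i] become deltas in [h]; otherwise the cubic delta terms vanish. Either
   way a polynomial identity in the remaining deltas is left. *)
by have [->|_] /= := eqVneq i h; ring.
Qed.

(** * Closed forms of the tensors of the Berwald-Moór metric *)

Section BerwaldMoor.
Variables (R : realType) (n : nat) (x : 'rV[R]_n).
Local Notation K := (berwald_moor R n x).
Local Notation D := (positive_momenta R n).
Local Notation a := (n%:R^-1 : R).
Local Notation c := (@torsion_coef R n).

Lemma berwald_moor_gt0 p : D p -> 0 < K p.
Proof. by move=> Dp; apply: powR_gt0; apply: prodr_gt0 => i _; exact: Dp. Qed.

Lemma lup_berwald_moor i p : D p -> lup K i p = a * (p 0 i)^-1 * K p.
Proof.
move=> Dp; apply: (dmom_log_weight (w := fun=> a)) => //.
exact: log_weight_berwald_moor.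
Qed.

Lemma hup_berwald_moor i j p : D p ->
  hup K i j p = K p ^+ 2 * (p 0 i)^-1 * (p 0 j)^-1 * (a ^+ 2 - a * (i == j)%:R).
Proof.
move=> Dp; rewrite /hup.
have w := log_weightM (log_weightM (log_weight_cst n a) (log_weight_inv_coord R j))
  (log_weight_berwald_moor x).
rewrite (dmom_log_weight i w (fun q Dq => lup_berwald_moor j Dq) Dp) eq_sym.
ring.
Qed.

Lemma gup_berwald_moor i j p : D p ->
  gup K i j p = metric_coef R i j * K p * K p * (p 0 i)^-1 * (p 0 j)^-1.
Proof.
move=> Dp; rewrite /gup.
have KK := log_weightM (log_weight_berwald_moor x) (log_weight_berwald_moor x).
have dKK q : D q -> dmom j (fun q => K q ^+ 2) q = 2 * a * (q 0 j)^-1 * (K q * K q).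
  by move=> Dq; rewrite (dmom_log_weight j KK _ Dq) //; ring.
have w := log_weightM (log_weightM (log_weight_cst n (2 * a))
  (log_weight_inv_coord R j)) KK.
rewrite (dmom_log_weight i w dKK Dp) /metric_coef eq_sym.
by field; rewrite !positive_momenta_neq0 // (natr_ord_neq0 R i).
Qed.

Lemma gdown_berwald_moor i j p : D p ->
  gdown K i j p = (K p ^+ 2)^-1 * p 0 i * p 0 j * (2 - n%:R * (i == j)%:R).
Proof.
move=> Dp; rewrite /gdown.
have K0 : K p != 0 by rewrite gt_eqF // berwald_moor_gt0.
set G := \matrix_(_, _) _.
pose H := \matrix_(i < n, j < n)
  ((K p ^+ 2)^-1 * p 0 i * p 0 j * (2 - n%:R * (i == j)%:R)).
(* A right inverse of a square matrix is its inverse, so checking one product suffices. *)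
suff GH : G *m H = 1%:M.
  have [Gu _] := mulmx1_unit GH.
  by rewrite -[invmx G]mulmx1 -GH mulKmx // mxE.
apply/matrixP => s t; rewrite !mxE.
have n0 := natr_ord_neq0 R s.
have p0 r : p 0 r != 0 by exact: positive_momenta_neq0.
(* Up to the factor [p_t / p_s], the sum is [4 n a^2 - 2a + delta_st - 2a], which is [delta_st]
   because [n a = 1]. *)
rewrite (eq_bigr (fun r => (p 0 s)^-1 * p 0 t * (4 * a ^+ 2)
     + (r == s)%:R * ((p 0 s)^-1 * p 0 t * (- 2 * a + (r == t)%:R))
     + (r == t)%:R * ((p 0 s)^-1 * p 0 t * (- 2 * a)))); last first.
  move=> r _; rewrite !mxE gup_berwald_moor // /metric_coef (eq_sym s).
  by field; rewrite n0 K0 !p0.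
rewrite (sum_cst_delta2 _ _ _ (fun r => _ * (_ + (r == t)%:R)) (fun=> _)).
by have [->|_] /= := eqVneq s t; field; rewrite n0 !p0.
Qed.

Lemma cartanCup_berwald_moor i j k p : D p ->
  cartanCup K i j k p =
  - c i j k * K p * K p * (p 0 i)^-1 * (p 0 j)^-1 * (p 0 k)^-1.
Proof.
move=> Dp; rewrite /cartanCup.
have w := log_weightM (log_weightM (log_weightM (log_weightM
  (log_weight_cst n (metric_coef R i j)) (log_weight_berwald_moor x))
  (log_weight_berwald_moor x)) (log_weight_inv_coord R i)) (log_weight_inv_coord R j).
rewrite (dmom_log_weight k w (fun q Dq => gup_berwald_moor i j Dq) Dp).
rewrite /metric_coef /torsion_coef (eq_sym k i).
(* Differentiation yields [delta_ij (delta_ik + delta_jk) / 2]; the case split identifies it with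
   [delta_ij delta_jk]. *)
by have [->|_] /= := eqVneq i j; field;
   rewrite !positive_momenta_neq0 // (natr_ord_neq0 R i).
Qed.

Lemma cartanC1_berwald_moor i j k p : D p ->
  cartanC1 K i j k p = n%:R * c i j k * p 0 i * (p 0 j)^-1 * (p 0 k)^-1.
Proof.
move=> Dp; rewrite /cartanC1.
have K0 : K p != 0 by rewrite gt_eqF // berwald_moor_gt0.
have p0 r : p 0 r != 0 by exact: positive_momenta_neq0.
rewrite (eq_bigr (fun s => (- 2 * (p 0 i * (p 0 j)^-1 * (p 0 k)^-1)) * c s j k
     + (s == i)%:R * (n%:R * c s j k * p 0 i * (p 0 j)^-1 * (p 0 k)^-1))); last first.
  move=> s _; rewrite gdown_berwald_moor // cartanCup_berwald_moor // (eq_sym i).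
  by field; rewrite K0 !p0.
by rewrite big_split /= sum_delta -mulr_sumr sum_torsion_coef mulr0 add0r.
Qed.

(** This trace runs over two equal indices, unlike [sum_torsion_coef]:
    [c_rir = 2a^3 - a^2 + delta_ri (a - 2a^2)], whose sum over [r] is [(2a^2 - a) + (a - 2a^2)]. *)
Lemma torsion_covector_berwald_moor i p : D p -> torsion_covector K i p = 0.
Proof.
move=> Dp; rewrite /torsion_covector.
have n0 := natr_ord_neq0 R i.
have p0 r : p 0 r != 0 by exact: positive_momenta_neq0.
rewrite (eq_bigr (fun r => n%:R * (p 0 i)^-1 * (2 * a ^+ 3 - a ^+ 2)
    + (r == i)%:R * (n%:R * (p 0 i)^-1 * (a - 2 * a ^+ 2)))); last first.
  move=> r _; rewrite cartanC1_berwald_moor // /torsion_coef eqxx (eq_sym i r).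
  by case: (_ == _) => /=; field; rewrite n0 !p0.
rewrite big_split /= sum_delta sumr_const card_ord -[X in X + _]mulr_natl.
by field; rewrite n0 p0.
Qed.

(** The powers of [p_r] cancel between the lowered and the raised index, leaving [- n] times the
    contraction [sum_torsion_coef_sq]. *)
Lemma sum_CC_berwald_moor i j h k p : D p ->
  \sum_(r < n) cartanC1 K r i j p * cartanCup K r h k p =
  K p ^+ 2 * (p 0 h)^-1 * (p 0 i)^-1 * (p 0 j)^-1 * (p 0 k)^-1 *
  (a * (c i h k + c j h k) - (i == j)%:R * c i h k).
Proof.
move=> Dp.
have n0 := natr_ord_neq0 R i.
have p0 r : p 0 r != 0 by exact: positive_momenta_neq0.
rewrite (eq_bigr (fun r => - n%:R * K p ^+ 2 * (p 0 h)^-1 * (p 0 i)^-1 * (p 0 j)^-1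
    * (p 0 k)^-1 * (c r i j * c r h k))); last first.
  move=> r _; rewrite cartanC1_berwald_moor // cartanCup_berwald_moor //.
  by field; rewrite !p0.
rewrite -mulr_sumr sum_torsion_coef_sq.
by field; rewrite n0 !p0.
Qed.

Lemma vcurvature_berwald_moor h i j k p : D p ->
  K p ^+ 2 * vcurvature K h i j k p =
  - (hup K h j p * hup K i k p - hup K h k p * hup K i j p).
Proof.
move=> Dp; rewrite /vcurvature.
(* Without the patterns, matching the wrong sum first unfolds the derivatives
   and does not terminate in practice. *)
rewrite [X in _ * (X - _)]sum_CC_berwald_moor // [X in _ * (_ - X)]sum_CC_berwald_moor //.
rewrite !hup_berwald_moor //.
(* The monomial common to all terms on both sides. *)
pose b := K p ^+ 4 * (p 0 h)^-1 * (p 0 i)^-1 * (p 0 j)^-1 * (p 0 k)^-1.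
have /(congr1 ( *%R b)) := torsion_coef_curvature R h i j k.
rewrite /b => E; apply: (etrans _ (etrans E _)); ring.
Qed.

Lemma dmom_cartanCup_berwald_moor h i j k p : D p ->
  dmom k (cartanCup K h i j) p =
  - (2 * a - (h == k)%:R - (i == k)%:R - (j == k)%:R) * c h i j
  * K p ^+ 2 * (p 0 h)^-1 * (p 0 i)^-1 * (p 0 j)^-1 * (p 0 k)^-1.
Proof.
move=> Dp.
have w := log_weightM (log_weightM (log_weightM (log_weightM (log_weightM
  (log_weight_cst n (- c h i j)) (log_weight_berwald_moor x))
  (log_weight_berwald_moor x)) (log_weight_inv_coord R h)) (log_weight_inv_coord R i))
  (log_weight_inv_coord R j).
rewrite (dmom_log_weight k w (fun q Dq => cartanCup_berwald_moor h i j Dq) Dp).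
ring.
Qed.

(** Serves to bring a contracted index to the first slot, as [sum_CC_berwald_moor] expects. *)
Lemma cartanCup_berwald_moor_rot i j k p : D p ->
  cartanCup K i j k p = cartanCup K j k i p.
Proof.
move=> Dp; rewrite !cartanCup_berwald_moor // torsion_coef_rot; ring.
Qed.

(** The delta terms of the derivative cancel those of the three contractions. Of the multiples of
    [c_hij], the derivative gives [-2a] and the contractions [3a], so a single [a] remains. *)
Lemma vcovC_berwald_moor h i j k p : D p ->
  vcovC K h i j k p =
  a * K p ^+ 2 * (p 0 h)^-1 * (p 0 i)^-1 * (p 0 j)^-1 * (p 0 k)^-1
  * (c h i j + c i j k + c j k h + c k h i).
Proof.
move=> Dp; rewrite /vcovC.
have E1 : \sum_(r < n) cartanCup K r i j p * cartanC1 K r h k p =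
    \sum_(r < n) cartanC1 K r h k p * cartanCup K r i j p.
  by apply: eq_bigr => r _; rewrite mulrC.
have E2 : \sum_(r < n) cartanCup K h r j p * cartanC1 K r i k p =
    \sum_(r < n) cartanC1 K r i k p * cartanCup K r j h p.
  by apply: eq_bigr => r _; rewrite mulrC (cartanCup_berwald_moor_rot h).
have E3 : \sum_(r < n) cartanCup K h i r p * cartanC1 K r j k p =
    \sum_(r < n) cartanC1 K r j k p * cartanCup K r h i p.
  by apply: eq_bigr => r _; rewrite mulrC -(cartanCup_berwald_moor_rot r).
rewrite [X in X + _ + _ + _]dmom_cartanCup_berwald_moor //.
rewrite [X in _ + X + _ + _]E1 [X in _ + X + _]E2 [X in _ + X]E3.
rewrite [X in _ + X + _ + _]sum_CC_berwald_moor // [X in _ + X + _]sum_CC_berwald_moor //.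
rewrite [X in _ + X]sum_CC_berwald_moor //.
rewrite (torsion_coef_swap R k j h) (torsion_coef_rot R k i j).
rewrite (torsion_coef_rot R j h i) (torsion_coef_rot R h i j).
ring.
Qed.

(** Each product such as [l^h C^ijk] is [- a c_ijk K^3 / (p_h p_i p_j p_k)], so the four of them
    cancel the four terms of [K C^hij|^k] one by one. *)
Lemma Ttensor_berwald_moor h i j k p : D p -> Ttensor K h i j k p = 0.
Proof.
move=> Dp; rewrite /Ttensor vcovC_berwald_moor //.
rewrite !lup_berwald_moor // !cartanCup_berwald_moor //; ring.
Qed.
End BerwaldMoor.

Theorem theorem5p1 (R : realType) (n : nat) (hn : (4 <= n)%N)
    (U : set 'rV[R]_n) (hU : open U) :
  let K := berwald_moor R n in
  let D := positive_momenta R n in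
  (forall x p, U x -> D p -> forall i : 'I_n, torsion_covector (K x) i p = 0) /\
  S3_like U D K (fun _ _ => -1) /\
  (forall x p, U x -> D p -> forall h i j k : 'I_n, Ttensor (K x) h i j k p = 0).
Proof.
split=> [x p _ Dp i|]; first exact: torsion_covector_berwald_moor.
split=> [|x p _ Dp h i j k]; last exact: Ttensor_berwald_moor.
split=> [//|x p _ Dp h i j k].
by rewrite vcurvature_berwald_moor // mulN1r.
Qed.
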